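(* Let $\alpha>1$ be an integer and, for an integer $a$ with $a>-\alpha^{2/3}/(1+\alpha^{1/3})$, let \[ A=\begin{pmatrix} a&\alpha&\alpha\\ 1&a&\alpha\\ 1&1&a\end{pmatrix}, \] with eigenvalues $\beta_1=a+\alpha^{1/3}+\alpha^{2/3}$, $\beta_2=a+\alpha^{1/3}\omega+\alpha^{2/3}\omega^2$, $\beta_3=a+\alpha^{2/3}\omega+\alpha^{1/3}\omega^2$, where $\omega=\exp(2\pi i/3)$; here $\beta_1>|\beta_2|=|\beta_3|$ and the rate of convergence of $A_{n,2,1}/A_{n,3,1}\to\alpha^{1/3}$ is governed by the ratio $|\beta_2/\beta_1|$. Then the choice of such an integer $a$ giving the most rapid convergence (i.e. minimizing $|\beta_2/\beta_1|$) is one of the two integers closest to \[ \bar a=\frac{\alpha^{1/3}+\alpha}{1+\alpha^{1/3}}. \] Moreover, for this choice of $a$ and every $n\ge 3$, \[ \frac{A_{n,2,1}}{A_{n,3,1}}-\alpha^{1/3}=\left((\omega-1)\,\omega\left(\left(\frac{-\omega}{2}\right)^n-\left(\frac{-\omega^2}{2}\right)^n\right)+\frac{n\,\delta_3}{2^n\alpha^{1/3}}+\frac{\delta_4}{2^{2n}}\right)\alpha^{1/3}, \] where $\delta_3,\delta_4$ are complex numbers (depending on $n$ and $\alpha$) with $|\delta_3|\le 8$ and $|\delta_4|\le 48$.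
   Context: $A_{n,i,j}$ denotes the $(i,j)$-th entry of the matrix power $A^n$. *)

(* Defs.v *)
From mathcomp Require Import all_boot all_order all_algebra.
From mathcomp Require Import all_classical all_reals all_analysis.
From mathcomp Require Import complex.

Set Implicit Arguments.
Unset Strict Implicit.
Unset Printing Implicit Defensive.

Import Order.TTheory GRing.Theory Num.Theory.
Import numFieldNormedType.Exports.

Local Open Scope classical_set_scope.
Local Open Scope ring_scope.
Local Open Scope complex_scope.

Definition cbrt_mx (alpha a : int) : 'M[int]_3 :=
  \matrix_(i < 3, j < 3)
    if i == j then a else if (i < j)%N then alpha else 1.

Section CubeRoot.
Context (R : realType).
Implicit Types alpha a : int.

Definition cbrt alpha : R := alpha%:~R `^ (1 / 3).
Definition cbrt2 alpha : R := alpha%:~R `^ (2 / 3).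

(* omega = exp(2 pi i / 3); the library has no complex exponential *)
Definition omega : R[i] := cos (2 * pi / 3) +i* sin (2 * pi / 3).

Definition beta1 alpha a : R[i] :=
  a%:~R + (cbrt alpha)%:C + (cbrt2 alpha)%:C.
Definition beta2 alpha a : R[i] :=
  a%:~R + (cbrt alpha)%:C * omega + (cbrt2 alpha)%:C * omega ^+ 2.
Definition beta3 alpha a : R[i] :=
  a%:~R + (cbrt2 alpha)%:C * omega + (cbrt alpha)%:C * omega ^+ 2.

Definition admissible alpha a : Prop :=
  - (cbrt2 alpha / (1 + cbrt alpha)) < a%:~R.

(* A_{n,2,1} / A_{n,3,1}: rows and columns of 'M_3 are numbered from 0 *)
Definition entry_quot alpha a (n : nat) : R :=
  ((cbrt_mx alpha a ^+ n) 1 0)%:~R / ((cbrt_mx alpha a ^+ n) 2 0)%:~R.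

(* the norm of R[i] takes its (real) values in R[i], hence the projection *)
Definition conv_ratio alpha a : R :=
  complex.Re `|beta2 alpha a / beta1 alpha a|.

(* r is the exact geometric rate at which u tends to l:
   u - l is O(r^n) and is not o(r^n) *)
Definition geometric_rate (u : nat -> R) (l r : R) : Prop :=
  (exists C : R, \forall n \near \oo, `|u n - l| <= C * r ^+ n) /\
  (exists2 c : R, 0 < c &
    forall N : nat, exists2 n, (N <= n)%N & c * r ^+ n <= `|u n - l|).

Definition fastest alpha a : Prop :=
  admissible alpha a /\
  forall b : int, admissible alpha b -> conv_ratio alpha a <= conv_ratio alpha b.

Definition abar alpha : R := (cbrt alpha + alpha%:~R) / (1 + cbrt alpha).

(* The pair {a, b} is unique when it exists; it does not exist for x an integer,
   whose second closest integer is ambiguous. *)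
Definition one_of_two_closest (x : R) a : Prop :=
  exists2 b : int, b != a &
    forall c : int, c != a -> c != b ->
      `|a%:~R - x| < `|c%:~R - x| /\ `|b%:~R - x| < `|c%:~R - x|.

End CubeRoot.

(* Main.v *)
(** Over the roots [zeta] of [zeta ^ 3 = alpha], the row [(1, zeta, zeta ^ 2)] is a
    left eigenvector of [A], so the first column [(x, y, z)] of [A ^ n] satisfies
    [x + y zeta + z zeta ^ 2 = (a + zeta + zeta ^ 2) ^ n].  With
    [t = alpha ^ (1/3)] and [m = beta2 / beta1], Fourier inversion gives
      [y / z - t = t (w ^ 2 - w) (m ^ n - m^* ^ n) / (1 + w m ^ n + w ^ 2 m^* ^ n)],
    and the rate is exactly [|m|] because [m] is not real.

    Writing [u = a + t + t ^ 2], one has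
      [|m| ^ 2 = 1 - 3 t ((1 + t) / u - t (1 + t + t ^ 2) / u ^ 2)],
    the maximum of a concave quadratic in [1 / u], attained at [a = abar]; as [abar]
    is never an integer, the best [a] is its floor or its ceiling.  For these,
    [eta = a - t ^ 2 + t] lies in (0, 3), whence [|2 m| <= 1] and
    [t |2 m + w| <= 2]: replacing [2 m] by [- w] yields the expansion. *)
Require Import Defs.
From mathcomp Require Import all_boot all_order all_algebra.
From mathcomp Require Import all_classical all_reals all_analysis.
From mathcomp Require Import complex.
From mathcomp Require Import ring lra zify.
Import Order.TTheory GRing.Theory Num.Theory.
Import numFieldNormedType.Exports.
Local Open Scope classical_set_scope.
Local Open Scope ring_scope.
Local Open Scope complex_scope.

(** * The primitive cube root of unity *)

Lemma cos_2pi3 (R : realType) : cos (2 * pi / 3) = - (1 / 2) :> R.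
Proof.
set x : R := 2 * pi / 3.
have pi0 := pi_gt0 R.
have s0 : 0 < sin x by apply: sin_gt0_pi; rewrite /x; lra.
have c3 : cos (x + x + x) = 1 by rewrite -(cos2pi R); congr cos; rewrite /x; lra.
have e := cos2Dsin2 x.
have se : sin x ^+ 2 = 1 - cos x ^+ 2 by lra.
move: c3; rewrite !(cosD, sinD) => c3.
(* Triple-angle formula applied to [cos (x + x + x) = 1]. The root [cos x = 1] is excluded below
   because [sin x] is positive. *)
have {c3} : (cos x - 1) * (2 * cos x + 1) ^+ 2 = 0.
  transitivity (4 * cos x ^+ 3 - 3 * cos x - 1); first by ring.
  rewrite -[X in _ - X]c3.
  transitivity (3 * cos x * (cos x ^+ 2 + sin x ^+ 2 - 1)); first by ring.
  by rewrite e; ring.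
move/eqP; rewrite mulf_eq0 sqrf_eq0 => /orP[/eqP h|/eqP h]; last by lra.
have c1 : cos x = 1 by lra.
by rewrite c1 in e; nra.
Qed.

Lemma omegaE (R : realType) : omega R = (- (1 / 2)) +i* (Num.sqrt 3 / 2).
Proof.
rewrite /omega cos_2pi3; congr (_ +i* _).
have pi0 := pi_gt0 R.
have s0 : 0 < sin (2 * pi / 3 : R) by apply: sin_gt0_pi; lra.
have e := cos2Dsin2 (2 * pi / 3 : R); rewrite cos_2pi3 in e.
apply/eqP; rewrite -(@eqrXn2 _ 2) ?(ltW s0) ?divr_ge0 ?sqrtr_ge0 //.
by rewrite expr_div_n sqr_sqrtr //; apply/eqP; lra.
Qed.

Lemma omega_root (R : realType) : omega R ^+ 2 + omega R + 1 = 0.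
Proof.
rewrite omegaE expr2; apply/eqP; rewrite eq_complex; simpc => /=.
have e : Num.sqrt 3 ^+ 2 = 3 :> R by rewrite sqr_sqrtr.
by apply/andP; split; apply/eqP; lra.
Qed.

Lemma omega2E (R : realType) : omega R ^+ 2 = - omega R - 1.
Proof. by have := omega_root R; move=> h; rewrite -[LHS]subr0 -h; ring. Qed.

Lemma omega_conj (R : realType) : (omega R)^* = omega R ^+ 2.
Proof.
rewrite omega2E omegaE; simpc; congr (_ +i* _).
lra.
Qed.

(** * Cube roots of alpha, powers of A and the eigenvalues *)

Lemma cbrtK (R : realType) (alpha : int) : 1 < alpha ->
  cbrt R alpha ^+ 3 = alpha%:~R.
Proof.
move=> h; have a0 : 0 <= alpha%:~R :> R by rewrite ler0z ltW // (lt_trans _ h).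
rewrite /cbrt -powR_mulrn ?powR_ge0 // -powRrM.
by rewrite (_ : 1 / 3 * 3%:R = 1) ?powRr1 //; lra.
Qed.

Lemma cbrt_gt1 (R : realType) (alpha : int) : 1 < alpha -> 1 < cbrt R alpha.
Proof.
move=> h; have t0 : 0 <= cbrt R alpha by exact: powR_ge0.
rewrite -(@ltr_pXn2r _ 3) ?nnegrE //.
by rewrite cbrtK // expr1n ltr1z.
Qed.

Lemma cbrt2E (R : realType) (alpha : int) : cbrt2 R alpha = cbrt R alpha ^+ 2.
Proof.
rewrite /cbrt2 /cbrt -powR_mulrn ?powR_ge0 // -powRrM.
by congr (_ `^ _); lra.
Qed.

(** Column [j] of A lists the coordinates of [(a + z + z ^+ 2) * z ^+ j] on 1, z, z^2 once z^3 is
    replaced by alpha: A is multiplication by a + z + z^2 in that basis. *)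
Lemma cbrt_mx_row (K : comPzRingType) (alpha a : int) (z : K) (j : 'I_3) :
  z ^+ 3 = alpha%:~R ->
  \sum_(i < 3) z ^+ i * (cbrt_mx alpha a i j)%:~R
    = (a%:~R + z + z ^+ 2) * z ^+ j.
Proof.
move=> e; rewrite !big_ord_recl big_ord0 !mxE /=.
case: j => [[|[|[|//]]] hj] /=; 
  rewrite -?(inj_eq val_inj) /= /bump /= ?expr0 ?expr1 -?e; ring.
Qed.

(** The row of powers of z is paired with column 0 of A^n. Each factor A, met from the left,
    releases one eigenvalue, and for n = 0 the pairing is z^0 = 1. *)
Lemma cbrt_mx_exp_col (K : comPzRingType) (alpha a : int) (z : K) (n : nat) :
  z ^+ 3 = alpha%:~R ->
  ((cbrt_mx alpha a ^+ n) 0 0)%:~R + ((cbrt_mx alpha a ^+ n) 1 0)%:~R * z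
    + ((cbrt_mx alpha a ^+ n) 2 0)%:~R * z ^+ 2 = (a%:~R + z + z ^+ 2) ^+ n.
Proof.
move=> e.
transitivity (\sum_(i < 3) z ^+ i * ((cbrt_mx alpha a ^+ n) i 0)%:~R).
  rewrite !big_ord_recl big_ord0 /=.
  have -> : lift ord0 ord0 = 1 :> 'I_3 by apply: val_inj.
  have -> : lift ord0 (lift ord0 ord0) = 2 :> 'I_3 by apply: val_inj.
  by rewrite /bump /= expr0 expr1; ring.
elim: n => [|n IHn].
  rewrite !big_ord_recl big_ord0 /= !mxE /=; ring.
rewrite exprS [in RHS]exprS -IHn big_distrr /=.
under eq_bigr do rewrite mxE rmorph_sum big_distrr /=.
rewrite exchange_big; apply: eq_bigr => j _ /=.
rewrite mulrA -(cbrt_mx_row K alpha a z j e) big_distrl /=.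
by apply: eq_bigr => i _; rewrite intrM mulrA.
Qed.

Lemma beta1E (R : realType) (alpha a : int) :
  beta1 R alpha a = (a%:~R + cbrt R alpha + cbrt R alpha ^+ 2)%:C.
Proof. by rewrite /beta1 cbrt2E !rmorphD /= rmorph_int. Qed.

Lemma beta2E (R : realType) (alpha a : int) (t := cbrt R alpha) :
  beta2 R alpha a =
  (a%:~R - (t + t ^+ 2) / 2) +i* (Num.sqrt 3 / 2 * (t - t ^+ 2)).
Proof.
rewrite /beta2 cbrt2E -/t omega2E omegaE -(rmorph_int (real_complex R)).
by simpc; congr (_ +i* _); field.
Qed.

Lemma beta3_conj (R : realType) (alpha a : int) :
  beta3 R alpha a = (beta2 R alpha a)^*.
Proof.
rewrite beta2E /beta3 cbrt2E omega2E omegaE -(rmorph_int (real_complex R)).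
by simpc; congr (_ +i* _); field.
Qed.

Lemma beta_ratio3_conj (R : realType) (alpha a : int) :
  beta3 R alpha a / beta1 R alpha a = (beta2 R alpha a / beta1 R alpha a)^*.
Proof. by rewrite beta3_conj [in RHS]rmorphM /= conjc_inv beta1E conjc_real. Qed.

(** Written as the square of [beta1] minus a defect, since for t > 1 the factor (1 + t) a + t^2 is
    positive exactly when a is admissible. *)
Lemma norm_beta2_sqr (R : realType) (alpha a : int) (t := cbrt R alpha) :
  `|beta2 R alpha a| ^+ 2 =
  ((a%:~R + t + t ^+ 2) ^+ 2 - 3 * t * ((1 + t) * a%:~R + t ^+ 2))%:C.
Proof.
rewrite -add_Re2_Im2 beta2E -/t /= exprMn expr_div_n sqr_sqrtr //.
by congr (_%:C); field.
Qed.

Lemma omega_exp3 (R : realType) : omega R ^+ 3 = 1.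
Proof.
transitivity ((omega R - 1) * (omega R ^+ 2 + omega R + 1) + 1); first by ring.
by rewrite omega_root; ring.
Qed.

Lemma cbrt_omega_exp3 (R : realType) (alpha : int)
    (t := (cbrt R alpha)%:C) (w := omega R) : 1 < alpha ->
  [/\ t ^+ 3 = alpha%:~R, (t * w) ^+ 3 = alpha%:~R
    & (t * w ^+ 2) ^+ 3 = alpha%:~R].
Proof.
move=> h.
have t3 : t ^+ 3 = alpha%:~R by rewrite -rmorphXn /= cbrtK // rmorph_int.
have w6 : (w ^+ 2) ^+ 3 = 1 by rewrite exprAC omega_exp3 expr1n.
by split=> //; rewrite exprMn t3 ?w6 ?omega_exp3 mulr1.
Qed.

Lemma betaE (R : realType) (alpha a : int)
    (t := (cbrt R alpha)%:C) (w := omega R) :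
  [/\ beta1 R alpha a = a%:~R + t + t ^+ 2,
      beta2 R alpha a = a%:~R + t * w + (t * w) ^+ 2
    & beta3 R alpha a = a%:~R + t * w ^+ 2 + (t * w ^+ 2) ^+ 2].
Proof.
have w4 : (w ^+ 2) ^+ 2 = w by rewrite -exprM exprS omega_exp3 mulr1.
rewrite /beta1 /beta2 /beta3 cbrt2E rmorphXn; split=> //; rewrite exprMn //.
by rewrite w4 addrAC.
Qed.

Lemma cbrt_mx_exp_col_beta (R : realType) (alpha a : int) (n : nat)
    (t := (cbrt R alpha)%:C) (w := omega R)
    (x := ((cbrt_mx alpha a ^+ n) 0 0)%:~R : R[i])
    (y := ((cbrt_mx alpha a ^+ n) 1 0)%:~R : R[i])
    (z := ((cbrt_mx alpha a ^+ n) 2 0)%:~R : R[i]) : 1 < alpha ->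
  [/\ x + y * t + z * t ^+ 2 = beta1 R alpha a ^+ n,
      x + y * (t * w) + z * (t * w) ^+ 2 = beta2 R alpha a ^+ n
    & x + y * (t * w ^+ 2) + z * (t * w ^+ 2) ^+ 2 = beta3 R alpha a ^+ n].
Proof.
move=> h.
have [e1 e2 e3] := cbrt_omega_exp3 R alpha h.
have [-> -> ->] := betaE R alpha a.
by rewrite !cbrt_mx_exp_col.
Qed.

(** Discrete Fourier inversion of the three relations of [cbrt_mx_exp_col_beta]: weighting them by
    powers of [w] cancels the unwanted coordinates through 1 + w + w^2 = 0. *)
Lemma cbrt_mx_exp_entries (R : realType) (alpha a : int) (n : nat)
    (t := (cbrt R alpha)%:C) (w := omega R)
    (b1 := beta1 R alpha a) (b2 := beta2 R alpha a) (b3 := beta3 R alpha a) :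
  1 < alpha ->
  3 * t * ((cbrt_mx alpha a ^+ n) 1 0)%:~R
    = b1 ^+ n + w ^+ 2 * b2 ^+ n + w * b3 ^+ n /\
  3 * t ^+ 2 * ((cbrt_mx alpha a ^+ n) 2 0)%:~R
    = b1 ^+ n + w * b2 ^+ n + w ^+ 2 * b3 ^+ n.
Proof.
move=> /(@cbrt_mx_exp_col_beta R alpha a n)[<- <- <-]; rewrite -/t -/w.
have w2 : w ^+ 2 = - w - 1 by exact: omega2E.
by split; ring: w2.
Qed.

(** * Moduli of the eigenvalues and of their ratio *)

Lemma ReK_norm (R : realType) (z : R[i]) : (complex.Re `|z|)%:C = `|z|.
Proof. by rewrite normc_def. Qed.

Lemma norm_omega (R : realType) : `|omega R| = 1.
Proof.
have : `|omega R| ^+ 2 = 1.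
  by rewrite sqr_normc omega_conj -exprS omega_exp3.
by move/eqP; rewrite sqrp_eq1 // => /eqP.
Qed.

Lemma norm_omega2B_sqr (R : realType) : `|omega R ^+ 2 - omega R| ^+ 2 = 3.
Proof.
have -> : omega R ^+ 2 - omega R = 0 +i* (- Num.sqrt 3).
  by rewrite omega2E omegaE; simpc; congr (_ +i* _); lra.
by rewrite -add_Re2_Im2 /= expr0n add0r sqrrN sqr_sqrtr // rmorph_nat.
Qed.

Lemma norm_omega2B_ge1 (R : realType) : 1 <= `|omega R ^+ 2 - omega R|.
Proof.
by rewrite -(@ler_pXn2r _ 2) ?nnegrE // norm_omega2B_sqr expr1n (ler_nat _ 1 3).
Qed.

Lemma norm_omega2B_le2 (R : realType) : `|omega R ^+ 2 - omega R| <= 2.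
Proof.
by rewrite -(@ler_pXn2r _ 2) ?nnegrE // norm_omega2B_sqr -natrX (ler_nat _ 3 4).
Qed.

Lemma admissible_gt0 (R : realType) (alpha a : int) (t := cbrt R alpha) :
  1 < alpha -> admissible R alpha a ->
  0 < (1 + t) * a%:~R + t ^+ 2 /\ 0 < a%:~R + t + t ^+ 2.
Proof.
move=> /(cbrt_gt1 R); rewrite /admissible cbrt2E -/t => t1.
rewrite -mulNr ltr_pdivrMr; last by lra.
move=> h; split; first by lra.
have -> : a%:~R + t + t ^+ 2 =
    ((a%:~R * (1 + t) + t ^+ 2) + t + t ^+ 2 + t ^+ 3) / (1 + t) by field; lra.
have t2 : 0 < t ^+ 2 by apply: exprn_gt0; lra.
have t3 : 0 < t ^+ 3 by apply: exprn_gt0; lra.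
by apply: divr_gt0; lra.
Qed.

Lemma conv_ratio_norm (R : realType) (alpha a : int) :
  `|beta2 R alpha a / beta1 R alpha a| = (conv_ratio R alpha a)%:C.
Proof. by rewrite /conv_ratio ReK_norm. Qed.

Lemma conv_ratio_ge0 (R : realType) (alpha a : int) : 0 <= conv_ratio R alpha a.
Proof. by rewrite -ler0c -conv_ratio_norm. Qed.

Lemma conv_ratio_sqr (R : realType) (alpha a : int) (t := cbrt R alpha)
    (u := a%:~R + t + t ^+ 2) : 0 < u ->
  conv_ratio R alpha a ^+ 2 = 1 - 3 * t * ((1 + t) * a%:~R + t ^+ 2) / u ^+ 2.
Proof.
move=> u0; apply: (@complexI R).
rewrite rmorphXn /= -conv_ratio_norm normf_div expr_div_n norm_beta2_sqr.
rewrite beta1E -/t -/u normc_def /= expr0n addr0 sqrtr_sqr -rmorphXn /=.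
rewrite real_normK ?num_real // -fmorphV -rmorphM /=; congr (_%:C).
by rewrite mulrBl divff ?expf_neq0 // gt_eqF.
Qed.

Lemma beta1_gt0 (R : realType) (alpha a : int) (t := cbrt R alpha) :
  0 < a%:~R + t + t ^+ 2 -> 0 < beta1 R alpha a.
Proof. by move=> h; rewrite beta1E ltcR. Qed.

(** * Error of the quotient, its exact rate, and the spectrum of A *)

Definition conv_denom (R : realType) (m : R[i]) (n : nat) : R[i] :=
  1 + omega R * m ^+ n + omega R ^+ 2 * (conjc m) ^+ n.

Lemma conv_denom_dist (R : realType) (m : R[i]) (n : nat) :
  `|conv_denom R m n - 1| <= 2 * `|m| ^+ n.
Proof.
have -> : conv_denom R m n - 1 = omega R * m ^+ n + omega R ^+ 2 * (conjc m) ^+ n.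
  by rewrite /conv_denom; ring.
rewrite (le_trans (ler_normD _ _)) //.
by rewrite !normrM !normrX normcJ norm_omega ?expr1n !mul1r -mulr2n mulr_natl.
Qed.

(** Both entries are divided by the n-th power of [beta1]. Subtracting t leaves the numerator (1 +
    w^2 m^n + w m'^n) - (1 + w m^n + w^2 m'^n) = (w^2 - w)(m^n - m'^n), with m' the conjugate of m.
    The entry is also shown to be nonzero because division by zero returns 0, so the equation alone
    would not say that the quotient is genuine. *)
Lemma entry_quot_error (R : realType) (alpha a : int) (n : nat)
    (t := cbrt R alpha) (m := beta2 R alpha a / beta1 R alpha a) :
  1 < alpha -> 0 < a%:~R + t + t ^+ 2 -> conv_denom R m n != 0 ->
  (cbrt_mx alpha a ^+ n) 2 0 != 0 /\
  (entry_quot R alpha a n - t)%:C =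
    (omega R ^+ 2 - omega R) * (m ^+ n - (conjc m) ^+ n) / conv_denom R m n * t%:C.
Proof.
move=> h /beta1_gt0/gt_eqF/negbT b1 d0.
have [ey ez] := @cbrt_mx_exp_entries R alpha a n h.
have t0 : t%:C != 0.
  by rewrite -(rmorph0 (real_complex R)) (inj_eq (@complexI R)) gt_eqF //
    (lt_trans ltr01 (cbrt_gt1 R alpha h)).
have b1n : beta1 R alpha a ^+ n != 0 by rewrite expf_neq0.
have mE : m ^+ n = beta2 R alpha a ^+ n / beta1 R alpha a ^+ n.
  by rewrite expr_div_n.
have mJE : (conjc m) ^+ n = beta3 R alpha a ^+ n / beta1 R alpha a ^+ n.
  by rewrite -beta_ratio3_conj expr_div_n.
have {ey} ey : 3 * t%:C * ((cbrt_mx alpha a ^+ n) 1 0)%:~R =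
    beta1 R alpha a ^+ n * (1 + omega R ^+ 2 * m ^+ n + omega R * (conjc m) ^+ n).
  by rewrite ey mE mJE; field.
(* This is the origin of [conv_denom]: the lower entry, normalised by its dominant term. *)
have {ez} ez : 3 * t%:C ^+ 2 * ((cbrt_mx alpha a ^+ n) 2 0)%:~R =
    beta1 R alpha a ^+ n * conv_denom R m n.
  by rewrite ez /conv_denom mE mJE; field.
have z0 : ((cbrt_mx alpha a ^+ n) 2 0)%:~R != 0 :> R[i].
  by apply: contra_neq (mulf_neq0 b1n d0) => z0; rewrite -ez z0 mulr0.
split; first by apply: contra_neq z0 => ->.
have -> : (entry_quot R alpha a n - t)%:C =
    ((cbrt_mx alpha a ^+ n) 1 0)%:~R / ((cbrt_mx alpha a ^+ n) 2 0)%:~R - t%:C.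
  by rewrite rmorphB /= /entry_quot fmorph_div !rmorph_int.
move: ey ez z0; set y := _%:~R; set z := (_ 2 0)%:~R => ey ez z0.
have -> : z = beta1 R alpha a ^+ n * conv_denom R m n / (3 * t%:C ^+ 2).
  by rewrite -ez; field.
have -> : y = beta1 R alpha a ^+ n
    * (1 + omega R ^+ 2 * m ^+ n + omega R * (conjc m) ^+ n) / (3 * t%:C).
  by rewrite -ey; field.
move: d0; rewrite /conv_denom => d0; field.
by rewrite d0 b1n t0.
Qed.

(** Single terms s_n = m^n - m'^n may be small, but s_{n+1} - m s_n = (m - m') m'^n has modulus
    |s_1| r^n, so two consecutive terms cannot both be small. *)
Lemma conj_pow_dist_lower (R : realType) (m : R[i]) (r : R) :
  `|m| = r%:C -> conjc m != m ->
  exists2 c : R, 0 < c & forall N : nat, exists2 n, (N <= n)%N &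
    (c * r ^+ n)%:C <= `|m ^+ n - (conjc m) ^+ n|.
Proof.
move=> mr mJ.
have r0 : 0 < r.
  rewrite -ltcR -mr normr_gt0; apply: contra_neq mJ => ->.
  by rewrite conjc0.
pose s n := m ^+ n - (conjc m) ^+ n; pose f n := complex.Re `|s n|.
have fE n : `|s n| = (f n)%:C by rewrite ReK_norm.
have d0 : 0 < f 1%N by rewrite -ltcR -fE normr_gt0 /s !expr1 subr_eq0 eq_sym.
have step n : f 1%N * r ^+ n <= f n.+1 + r * f n.
  rewrite -lecR rmorphD !rmorphM rmorphXn /= -!fE -mr.
  have -> : `|s 1%N| * `|m| ^+ n = `|s n.+1 - m * s n|.
    rewrite -(normcJ m) -normrX -normrM; congr `|_|.
    by rewrite /s !exprS; ring.
  by rewrite (le_trans (ler_normB _ _)) // normrM.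
(* This constant splits [step] evenly: if [f N] falls below it times r^N, then [r * f N] takes less
   than half of [f 1 * r ^+ N], and the other half bounds [f N.+1] from below. *)
exists (f 1%N / (2 * r)); first by rewrite divr_gt0 // mulr_gt0.
move=> N; have [h|h] := leP (f 1%N / (2 * r) * r ^+ N) (f N).
  by exists N => //; rewrite -/(s N) fE lecR.
exists N.+1 => //; rewrite -/(s N.+1) fE lecR.
have {h} : r * f N <= f 1%N * r ^+ N / 2.
  rewrite (le_trans (ler_wpM2l (ltW r0) (ltW h))) // le_eqVlt; apply/orP; left.
  by apply/eqP; field; rewrite gt_eqF.
have -> : f 1%N / (2 * r) * r ^+ N.+1 = f 1%N * r ^+ N / 2.
  by rewrite exprS; field; rewrite gt_eqF.
by have := step N; clear -R; lra.
Qed.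

Lemma conv_ratio_lt1 (R : realType) (alpha a : int) : 1 < alpha ->
  admissible R alpha a -> conv_ratio R alpha a < 1.
Proof.
move=> h /(admissible_gt0 R alpha a h)[v0 u0].
have t1 := cbrt_gt1 R alpha h.
rewrite -(@ltr_pXn2r _ 2) ?nnegrE ?conv_ratio_ge0 // conv_ratio_sqr // expr1n.
rewrite gtrBl divr_gt0 ?exprn_gt0 // mulr_gt0 // mulr_gt0 //.
exact: lt_trans t1.
Qed.

Lemma norm_beta2_lt_beta1 (R : realType) (alpha a : int) : 1 < alpha ->
  admissible R alpha a -> `|beta2 R alpha a| < beta1 R alpha a.
Proof.
move=> h ha; have [_ /beta1_gt0 b0] := admissible_gt0 R alpha a h ha.
have := conv_ratio_lt1 R alpha a h ha.
by rewrite -ltcR -conv_ratio_norm normf_div (gtr0_norm b0) ltr_pdivrMr // mul1r.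
Qed.

(** [beta1] is a positive real and the imaginary part of [beta2] is a nonzero multiple of t - t^2,
    which is negative for t > 1. *)
Lemma beta_ratio_nonreal (R : realType) (alpha a : int)
    (t := cbrt R alpha) (m := beta2 R alpha a / beta1 R alpha a) :
  1 < alpha -> 0 < a%:~R + t + t ^+ 2 -> conjc m != m.
Proof.
move=> h u0; have t1 := cbrt_gt1 R alpha h.
have b1 := beta1_gt0 R alpha a u0.
rewrite -beta_ratio3_conj beta3_conj (inj_eq (divIf (negbT (gt_eqF b1)))).
apply/eqP => /(congr1 (@complex.Im R)); rewrite beta2E -/t /=.
have : 0 < Num.sqrt 3 / 2 * (t ^+ 2 - t).
  by rewrite mulr_gt0 ?divr_gt0 ?sqrtr_gt0 //
    subr_gt0 expr2 ltr_pMr // (lt_trans ltr01).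
by clear b1; lra.
Qed.

Lemma conv_denom_near (R : realType) (m : R[i]) (r : R) :
  `|m| = r%:C -> r < 1 ->
  \forall n \near \oo, `|conv_denom R m n - 1| <= (1 / 2)%:C.
Proof.
move=> mr r1.
have r0 : 0 <= r by rewrite -ler0c -mr.
(* The distance to 1 is at most 2 r^n, so r^n <= 1/4 suffices. *)
have q0 : 0 < 1 / 4 :> R by lra.
have /cvg_expr /cvgr0_norm_le /(_ _ q0) hn : `|r| < 1 by rewrite ger0_norm.
near=> n.
apply: le_trans (conv_denom_dist R m n) _.
rewrite mr -(rmorph_nat (real_complex R)) -rmorphXn -rmorphM /= lecR.
have : `|r ^+ n| <= 1 / 4 by near: n.
by rewrite ger0_norm ?exprn_ge0 //; clear; lra.
Unshelve. all: by end_near.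
Qed.

Lemma norm_real_complex (R : realType) (x : R) : `|x%:C| = `|x|%:C.
Proof. by rewrite normc_def /= expr0n addr0 sqrtr_sqr. Qed.

Lemma norm_near1 (R : realType) (d : R[i]) (e : R) : `|d - 1| <= e%:C ->
  1 - e <= complex.Re `|d| <= 1 + e.
Proof.
move=> hd; rewrite -!lecR !ReK_norm rmorphB rmorphD /= rmorph1.
rewrite lerBlDr; apply/andP; split.
  have := ler_normD d (1 - d); rewrite addrC subrK normr1 => /le_trans; apply.
  by rewrite lerD2l distrC.
have := ler_normD 1 (d - 1); rewrite addrC subrK normr1 => /le_trans; apply.
by rewrite lerD2l.
Qed.

(** The error is t S times W / D with W = |w^2 - w| in [1, 2] and D the modulus of the denominator,
    in [1/2, 3/2]; hence W / D lies in [1/2, 4]. *)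
Lemma entry_quot_error_bounds (R : realType) (alpha a : int) (n : nat)
    (t := cbrt R alpha) (m := beta2 R alpha a / beta1 R alpha a)
    (S := complex.Re `|m ^+ n - (conjc m) ^+ n|) :
  1 < alpha -> 0 < a%:~R + t + t ^+ 2 ->
  `|conv_denom R m n - 1| <= (1 / 2)%:C ->
  t * S / 2 <= `|entry_quot R alpha a n - t| <= 4 * t * S.
Proof.
move=> h u0 /norm_near1 /andP[D1 D2].
have t1 := cbrt_gt1 R alpha h; rewrite -/t in t1.
set D := complex.Re _ in D1 D2.
have DE : D%:C = `|conv_denom R m n| by rewrite ReK_norm.
have d0 : conv_denom R m n != 0.
  by rewrite -normr_gt0 -DE ltcR; clear -D1; lra.
have [_ e] := entry_quot_error R alpha a n h u0 d0.
pose W := complex.Re `|omega R ^+ 2 - omega R|.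
have WE : W%:C = `|omega R ^+ 2 - omega R| by rewrite ReK_norm.
have W1 : 1 <= W by rewrite -lecR WE norm_omega2B_ge1.
have W2 : W <= 2 by rewrite -lecR WE rmorph_nat norm_omega2B_le2.
have SE : S%:C = `|m ^+ n - (conjc m) ^+ n| by rewrite ReK_norm.
have S0 : 0 <= S by rewrite -ler0c SE.
have -> : `|entry_quot R alpha a n - t| = W * S / D * t.
  apply: (@complexI R).
  rewrite -norm_real_complex !rmorphM (fmorphV (real_complex R)) /= WE SE DE e.
  by rewrite !normrM normfV norm_real_complex (gtr0_norm (lt_trans ltr01 t1)).
clear e DE SE WE u0.
have D0 : 0 < D by lra.
have tS : 0 <= t * S by apply: mulr_ge0 => //; lra.
rewrite (_ : W * S / D * t = t * S * (W / D)); last by ring.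
apply/andP; split.
  by rewrite ler_wpM2l // ler_pdivlMr //; lra.
rewrite (_ : 4 * t * S = t * S * 4); last by ring.
by rewrite ler_wpM2l // ler_pdivrMr //; lra.
Qed.

Lemma entry_quot_rate (R : realType) (alpha a : int) : 1 < alpha ->
  admissible R alpha a ->
  geometric_rate (entry_quot R alpha a) (cbrt R alpha) (conv_ratio R alpha a).
Proof.
move=> h ha; set t := cbrt R alpha; set r := conv_ratio R alpha a.
have [_ u0] := admissible_gt0 R alpha a h ha.
have t1 := cbrt_gt1 R alpha h; rewrite -/t in t1.
set m := beta2 R alpha a / beta1 R alpha a.
have mr : `|m| = r%:C by exact: conv_ratio_norm.
have dn := conv_denom_near R m r mr (conv_ratio_lt1 R alpha a h ha).
split.
  (* The factor 4 of the upper error bound times the 2 of |m^n - m'^n| <= 2 r^n. *)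
  exists (8 * t); near=> n.
  have hn : `|conv_denom R m n - 1| <= (1 / 2)%:C by near: n.
  have /andP[_] := entry_quot_error_bounds R alpha a n h u0 hn.
  rewrite -/m -/t => /le_trans; apply.
  have : complex.Re `|m ^+ n - (conjc m) ^+ n| <= 2 * r ^+ n.
    rewrite -lecR ReK_norm (rmorphM (real_complex R)) rmorphXn rmorph_nat /= -mr.
    rewrite (le_trans (ler_normB _ _)) // !normrX normcJ.
    by rewrite -mulr2n mulr_natl.
  move: (complex.Re _) => S hS.
  rewrite (_ : 8 * t * r ^+ n = 4 * t * (2 * r ^+ n)); last by ring.
  by rewrite ler_wpM2l // mulr_ge0 // ltW // (lt_trans ltr01).
have [c c0 hc] := conj_pow_dist_lower R m r mr (beta_ratio_nonreal R alpha a h u0).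
exists (t * c / 2); first by rewrite !mulr_gt0 // (lt_trans ltr01).
move=> N; case: dn => M _ hM.
(* The index must pass both [N] and the threshold [M] beyond which the denominator is close to 1. *)
have [n hn cn] := hc (maxn N M).
exists n; first by apply: leq_trans hn; exact: leq_maxl.
have hnM : `|conv_denom R m n - 1| <= (1 / 2)%:C.
  by apply: hM; apply: leq_trans hn; exact: leq_maxr.
have /andP[+ _] := entry_quot_error_bounds R alpha a n h u0 hnM.
apply: le_trans; rewrite -/m -/t.
rewrite (_ : t * c / 2 * r ^+ n = t * (c * r ^+ n) / 2); last by ring.
rewrite ler_pM2r // ler_pM2l ?(lt_trans ltr01) //.
by rewrite -lecR ReK_norm.
Unshelve. all: by end_near.
Qed.

Lemma geometric_rate_cvg (R : realType) (u : nat -> R) (l r : R) :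
  0 <= r < 1 -> geometric_rate u l r -> u n @[n --> \oo] --> l.
Proof.
move=> /andP[r0 r1] [[C hC] _].
have rn : r ^+ n @[n --> \oo] --> (0 : R) by apply: cvg_expr; rewrite ger0_norm.
have crn : C * r ^+ n @[n --> \oo] --> (0 : R).
  by rewrite -(mulr0 C); apply: cvgMr.
apply/cvgrPdist_le => e e0.
move/cvgr0_norm_le : crn => /(_ e e0) crn.
near=> n.
rewrite distrC (@le_trans _ _ (C * r ^+ n)) //; first by near: n.
by rewrite (le_trans (ler_norm _)) //; near: n.
Unshelve. all: by end_near.
Qed.

(** The three numbers are eigenvalues by the left eigenrows. They are distinct, since [beta1]
    dominates the other two in modulus and those are nonreal conjugates, so they exhaust the roots
    of a monic cubic. *)
Lemma cbrt_mx_char_poly (R : realType) (alpha a : int) : 1 < alpha ->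
  admissible R alpha a ->
  char_poly (map_mx intr (cbrt_mx alpha a) : 'M[R[i]]_3) =
    ('X - (beta1 R alpha a)%:P) * ('X - (beta2 R alpha a)%:P)
      * ('X - (beta3 R alpha a)%:P).
Proof.
move=> h ha; have [_ u0] := admissible_gt0 R alpha a h ha.
set M := map_mx _ _.
pose rs := [:: beta1 R alpha a; beta2 R alpha a; beta3 R alpha a].
have b12 := norm_beta2_lt_beta1 R alpha a h ha.
have b1 := beta1_gt0 R alpha a u0.
have urs : uniq rs.
  rewrite /= !inE negb_or !andbT -andbA; apply/and3P; split.
  - by apply: contraTneq b12 => <-; rewrite gtr0_norm // ltxx.
  - apply: contraTneq b12; rewrite beta3_conj -normcJ => <-.
    by rewrite gtr0_norm // ltxx.
  - apply: contra_neq (beta_ratio_nonreal R alpha a h u0).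
    by rewrite -beta_ratio3_conj => ->.
have ev (z : R[i]) : z ^+ 3 = alpha%:~R -> root (char_poly M) (a%:~R + z + z ^+ 2).
  move=> z3; rewrite -eigenvalue_root_char; apply/eigenvalueP.
  exists (\row_i z ^+ i).
    apply/rowP => j; rewrite !mxE -(cbrt_mx_row _ alpha a z j z3).
    by apply: eq_bigr => i _; rewrite !mxE.
  apply/eqP => /rowP/(_ 0)/eqP; rewrite !mxE expr0.
  by rewrite oner_eq0.
have [r1 r2 r3] := betaE R alpha a.
have [e1 e2 e3] := cbrt_omega_exp3 R alpha h.
have rr : all (root (char_poly M)) rs by rewrite /= r1 r2 r3 !ev.
rewrite -uniq_rootsE in urs.
rewrite (all_roots_prod_XsubC _ rr urs) ?size_char_poly //.
rewrite (monicP (char_poly_monic M)) scale1r /rs !big_cons big_nil.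
by rewrite mulr1 mulrA.
Qed.

(** * The integers that minimise the ratio *)

Lemma conv_ratio_ltE (R : realType) (alpha a b : int) (t := cbrt R alpha)
    (u := a%:~R + t + t ^+ 2) (v := b%:~R + t + t ^+ 2) :
  1 < alpha -> 0 < u -> 0 < v ->
  (conv_ratio R alpha b < conv_ratio R alpha a) =
    (0 < (v - u) * (t * (1 + t + t ^+ 2) * (u + v) - (1 + t) * u * v)).
Proof.
move=> h u0 v0.
have t0 : 0 < t := lt_trans ltr01 (cbrt_gt1 R alpha h).
rewrite -(@ltr_pXn2r _ 2) ?nnegrE ?conv_ratio_ge0 // !conv_ratio_sqr //.
rewrite -/t -/u -/v -subr_gt0.
(* Expressed through u and v alone, both squared ratios are the same quadratic in 1/u and 1/v, so
   their difference has the factor v - u. *)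
have -> : 1 - 3 * t * ((1 + t) * a%:~R + t ^+ 2) / u ^+ 2 -
    (1 - 3 * t * ((1 + t) * b%:~R + t ^+ 2) / v ^+ 2) =
    3 * t / (u * v) ^+ 2 *
      ((v - u) * (t * (1 + t + t ^+ 2) * (u + v) - (1 + t) * u * v)).
  have -> : (1 + t) * a%:~R + t ^+ 2 = (1 + t) * u - t * (1 + t + t ^+ 2).
    by rewrite /u; ring.
  have -> : (1 + t) * b%:~R + t ^+ 2 = (1 + t) * v - t * (1 + t + t ^+ 2).
    by rewrite /v; ring.
  by field; rewrite !gt_eqF.
by rewrite pmulr_rgt0 // divr_gt0 ?mulr_gt0 ?exprn_gt0 // mulr_gt0.
Qed.

(** Put Q = t (1 + t + t^2). Then b <= [abar] means (1 + t) v <= 2 Q, whence (1 + t) u v <= 2 Q u <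
    Q (u + v). To the right of [abar] the inequalities are mirrored. *)
Lemma conv_ratio_lt_left (R : realType) (alpha a b : int) : 1 < alpha ->
  admissible R alpha a -> admissible R alpha b ->
  a < b -> b%:~R <= abar R alpha -> conv_ratio R alpha b < conv_ratio R alpha a.
Proof.
move=> h ha hb ab; have t1 := cbrt_gt1 R alpha h.
have [_ u0] := admissible_gt0 R alpha a h ha.
have [_ v0] := admissible_gt0 R alpha b h hb.
rewrite conv_ratio_ltE // /abar ler_pdivlMr; last by lra.
rewrite -(cbrtK R alpha h).
move: (cbrt R alpha) t1 u0 v0 => t t1 u0 v0 hb2.
have {}ab : a%:~R < b%:~R :> R by rewrite ltr_int.
set u := a%:~R + t + t ^+ 2 in u0 *; set v := b%:~R + t + t ^+ 2 in v0 *.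
have uv : u < v by rewrite /u /v; lra.
have vm : (1 + t) * v <= 2 * (t * (1 + t + t ^+ 2)) by rewrite /v; lra.
rewrite mulr_gt0 ?subr_gt0 //.
have Q0 : 0 < t * (1 + t + t ^+ 2) by rewrite mulr_gt0 //; nra.
move: (t * _) Q0 vm => Q Q0 vm.
by rewrite (_ : (1 + t) * u * v = u * ((1 + t) * v)); [nra|ring].
Qed.

Lemma conv_ratio_lt_right (R : realType) (alpha a b : int) : 1 < alpha ->
  admissible R alpha a -> admissible R alpha b ->
  a < b -> abar R alpha <= a%:~R -> conv_ratio R alpha a < conv_ratio R alpha b.
Proof.
move=> h ha hb ab; have t1 := cbrt_gt1 R alpha h.
have [_ u0] := admissible_gt0 R alpha a h ha.
have [_ v0] := admissible_gt0 R alpha b h hb.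
rewrite conv_ratio_ltE // /abar ler_pdivrMr; last by lra.
rewrite -(cbrtK R alpha h).
move: (cbrt R alpha) t1 u0 v0 => t t1 u0 v0 hb2.
have {}ab : a%:~R < b%:~R :> R by rewrite ltr_int.
set u := a%:~R + t + t ^+ 2 in u0 *; set v := b%:~R + t + t ^+ 2 in v0 *.
have uv : u < v by rewrite /u /v; lra.
have um : 2 * (t * (1 + t + t ^+ 2)) <= (1 + t) * u by rewrite /u; lra.
rewrite nmulr_rgt0 ?subr_lt0 //.
have Q0 : 0 < t * (1 + t + t ^+ 2) by rewrite mulr_gt0 //; nra.
move: (t * _) Q0 um => Q Q0 um.
by rewrite (_ : (1 + t) * v * u = v * ((1 + t) * u)); [nra|ring].
Qed.

Lemma abar_gt1 (R : realType) (alpha : int) : 1 < alpha -> 1 < abar R alpha.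
Proof.
move=> h; have t1 := cbrt_gt1 R alpha h.
have a1 : 1 < alpha%:~R :> R by rewrite ltr1z.
by rewrite /abar ltr_pdivlMr; lra.
Qed.

(** This makes floor and ceiling of [abar] two distinct integers, strictly closest to it. If [abar]
    were k, then t (k - 1) = alpha - k; cubing shows that k - 1 divides alpha - k, so t would be an
    integer q, which is then excluded by divisibility. *)
Lemma abar_not_int (R : realType) (alpha k : int) : 1 < alpha ->
  abar R alpha != k%:~R.
Proof.
move=> h; have t1 := cbrt_gt1 R alpha h.
apply/eqP => e.
have {}e : cbrt R alpha * (k - 1)%:~R = (alpha - k)%:~R.
  have e2 : cbrt R alpha + alpha%:~R = k%:~R * (1 + cbrt R alpha).
    by rewrite -e /abar divfK // gt_eqF // addr_gt0 // (lt_trans ltr01).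
  by rewrite !intrB; clear -e2; lra.
have {}e : alpha * (k - 1) ^+ 3 = (alpha - k) ^+ 3.
  by apply/eqP; rewrite -(eqr_int R) intrM !rmorphXn /= -(cbrtK R alpha h) -exprMn e.
have km : k - 1 != 0.
  apply: contra_eq_neq e => k1.
  rewrite k1 expr0n mulr0 eq_sym expf_neq0 //; lia.
have /dvdzP[q eq] : (k - 1 %| alpha - k)%Z.
  by rewrite dvdzE -(@dvdn_pexp2r _ _ 3) // -!abszX -e abszM dvdn_mull.
have aq : alpha = q ^+ 3.
  by apply: (mulIf (expf_neq0 3 km)); rewrite e eq exprMn.
have q2 : 1 < q.
  rewrite aq in h; rewrite ltNge; apply/negP => q1.
  have [q0|q0] := leP 0 q.
    by have := exprn_ile1 3 q0 q1; rewrite leNgt h.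
  have : q ^+ 3 <= 0 by rewrite exprn_odd_le0 // ltW.
  by rewrite leNgt (lt_trans _ h).
(* From q^3 - k = q (k - 1). As q + 1 is at least 3, it cannot divide 2. *)
have : (q + 1) * (q ^+ 2 - q + 1 - (k - 1)) = 2.
  transitivity (q ^+ 3 - k - q * (k - 1) + 2); first by ring.
  by rewrite -aq eq; ring.
move: (q ^+ 2 - q + 1 - (k - 1)) => w qw.
have [w0|w0] := leP w 0.
  have : (q + 1) * w <= 0 by apply: mulr_ge0_le0 => //; lia.
  by rewrite qw.
have : 3 * 1 <= (q + 1) * w by apply: ler_pM => //; lia.
by rewrite qw.
Qed.

Lemma one_of_two_closest_itv (R : realType) (x : R) (k : int) :
  k%:~R < x < k%:~R + 1 ->
  one_of_two_closest x k /\ one_of_two_closest x (k + 1).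
Proof.
move=> /andP[x1 x2].
have far (c : int) : c != k -> c != k + 1 ->
    `|k%:~R - x| < `|c%:~R - x| /\ `|(k + 1)%:~R - x| < `|c%:~R - x|.
  move=> c1 c2; rewrite intrD.
  rewrite (ltr0_norm (_ : k%:~R - x < 0)); last by lra.
  rewrite (gtr0_norm (_ : k%:~R + 1%:~R - x > 0)); last by lra.
  have [ck|ck] : c <= k - 1 \/ k + 2 <= c by lia.
    have {}ck : c%:~R <= k%:~R - 1 :> R by rewrite -(ler_int R) intrB in ck.
    by rewrite (ltr0_norm (_ : c%:~R - x < 0)); lra.
  have {}ck : k%:~R + 2 <= c%:~R :> R by rewrite -(ler_int R) intrD in ck.
  by rewrite (gtr0_norm (_ : c%:~R - x > 0)); lra.
split; [exists (k + 1)|exists k]; first by lia.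
- by move=> c c1 c2; apply: far.
- by lia.
- by move=> c c1 c2; have [] := far c c2 c1.
Qed.

Lemma admissible_ge0 (R : realType) (alpha a : int) : 1 < alpha -> 0 <= a ->
  admissible R alpha a.
Proof.
move=> h a0; have t1 := cbrt_gt1 R alpha h.
have {}a0 : 0 <= a%:~R :> R by rewrite ler0z.
apply: lt_le_trans a0; rewrite oppr_lt0 cbrt2E divr_gt0 ?exprn_gt0 //; lra.
Qed.

Lemma abar_floor (R : realType) (alpha : int) (k := Num.floor (abar R alpha)) :
  1 < alpha -> k%:~R < abar R alpha < k%:~R + 1 /\ 1 <= k.
Proof.
move=> h; have := floor_itv (abar R alpha); rewrite -/k intrD => /andP[k1 k2].
split; first by rewrite k2 andbT lt_neqAle k1 andbT eq_sym abar_not_int.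
by rewrite /k floor_ge_int ltW // abar_gt1.
Qed.

Lemma fastest_floor_or_ceil (R : realType) (alpha a : int)
    (k := Num.floor (abar R alpha)) :
  1 < alpha -> fastest R alpha a -> a = k \/ a = k + 1.
Proof.
move=> h [ha hmin]; have [/andP[k1 k2] k0] := abar_floor R alpha h.
rewrite -/k in k1 k2 k0.
have hk : admissible R alpha k by apply: admissible_ge0 => //; lia.
have hk1 : admissible R alpha (k + 1) by apply: admissible_ge0 => //; lia.
have [ak|ak] := ltP a k.
  have := conv_ratio_lt_left R alpha a k h ha hk ak (ltW k1).
  by rewrite ltNge hmin.
have [ak1|ak1] := ltP (k + 1) a; last by lia.
have := conv_ratio_lt_right R alpha (k + 1) a h hk1 ha ak1.
by rewrite intrD ltNge hmin // => /(_ (ltW k2)).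
Qed.

(** Monotonicity on each side of [abar] compares every admissible integer with k or k + 1, so the
    better of these two is a minimum over an infinite set. *)
Lemma fastest_exists (R : realType) (alpha : int) : 1 < alpha ->
  exists a : int, fastest R alpha a.
Proof.
move=> h; have [/andP[k1 k2] k0] := abar_floor R alpha h.
set k := Num.floor _ in k1 k2 k0.
have hk : admissible R alpha k by apply: admissible_ge0 => //; lia.
have hk1 : admissible R alpha (k + 1) by apply: admissible_ge0 => //; lia.
have far (b : int) : admissible R alpha b ->
    conv_ratio R alpha k <= conv_ratio R alpha b \/
    conv_ratio R alpha (k + 1) <= conv_ratio R alpha b.
  move=> hb; have [bk|bk] := ltP b k.
    by left; apply: ltW; apply: conv_ratio_lt_left => //; exact: ltW.
  have [bk1|bk1] := ltP (k + 1) b.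
    by right; apply: ltW; apply: conv_ratio_lt_right => //; rewrite intrD ltW.
  have [->|->] : b = k \/ b = k + 1 by lia.
    by left.
  by right.
have [le|le] := lerP (conv_ratio R alpha k) (conv_ratio R alpha (k + 1)).
  exists k; split=> // b /far[//|]; exact: le_trans.
by exists (k + 1); split=> // b /far[|//]; apply: le_trans; exact: ltW.
Qed.

Lemma fastest_dist_abar (R : realType) (alpha a : int) : 1 < alpha ->
  fastest R alpha a -> `|a%:~R - abar R alpha| < 1.
Proof.
move=> h fa; have [/andP[k1 k2] _] := abar_floor R alpha h.
have [->|->] := fastest_floor_or_ceil R alpha a h fa; rewrite ?intrD;
  by rewrite ltr_norml; apply/andP; split; lra.
Qed.

(** * The expansion for the best a *)

Lemma abar_dist_lt1 (R : realType) (alpha a : int) (t := cbrt R alpha) :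
  1 < alpha -> `|a%:~R - abar R alpha| < 1 -> 0 < a%:~R - t ^+ 2 + t < 3.
Proof.
move=> h; have t1 := cbrt_gt1 R alpha h; rewrite -/t in t1.
(* The last summand lies in (1, 2), so moving by less than 1 keeps eta in (0, 3). *)
have -> : abar R alpha = t ^+ 2 - t + 2 * t / (1 + t).
  by rewrite /abar -(cbrtK R alpha h) -/t; field; apply: lt0r_neq0; lra.
have q1 : 1 < 2 * t / (1 + t) by rewrite ltr_pdivlMr; lra.
have q2 : 2 * t / (1 + t) < 2 by rewrite ltr_pdivrMr; lra.
by rewrite ltr_norml => /andP[b1 b2]; apply/andP; split; lra.
Qed.

Lemma conv_ratio_le_half (R : realType) (alpha a : int) (t := cbrt R alpha)
    (eta := a%:~R - t ^+ 2 + t) :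
  1 < alpha -> 0 < eta < 3 -> conv_ratio R alpha a <= 1 / 2.
Proof.
move=> h /andP[e0 e3]; have t1 := cbrt_gt1 R alpha h; rewrite -/t in t1.
have aE : a%:~R = t ^+ 2 - t + eta by rewrite /eta; ring.
have uE : a%:~R + t + t ^+ 2 = 2 * t ^+ 2 + eta by rewrite aE; ring.
have u0 : 0 < a%:~R + t + t ^+ 2.
  by rewrite uE addr_gt0 // mulr_gt0 // exprn_gt0 // (lt_trans ltr01).
rewrite -(@ler_pXn2r _ 2) ?nnegrE ?conv_ratio_ge0 ?divr_ge0 //.
rewrite conv_ratio_sqr // -/t lerBlDr -lerBlDl ler_pdivlMr ?exprn_gt0 //.
rewrite uE aE; move: eta e0 e3 {aE uE u0} => e e0 e3.
(* Up to the factor 3/4, the two sides differ by 4 t^2 (t - 1) + e (4 t - e). *)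
have p1 : 0 <= e * (4 * t - e) by apply: mulr_ge0; lra.
have p2 : 0 <= t ^+ 2 * (t - 1) by apply: mulr_ge0; [exact: sqr_ge0|lra].
nra.
Qed.

(** In 2 [beta2] + w [beta1] the t^2 terms cancel, leaving order t over a denominator above 2 t^2;
    hence the weight t on the left. *)
Lemma beta_ratio_dist_omega (R : realType) (alpha a : int) (t := cbrt R alpha)
    (eta := a%:~R - t ^+ 2 + t) :
  1 < alpha -> 0 < eta < 3 ->
  t%:C * `|2 * (beta2 R alpha a / beta1 R alpha a) - - omega R| <= 2.
Proof.
move=> h /andP[e0 e3]; have t1 := cbrt_gt1 R alpha h; rewrite -/t in t1.
have t0 : 0 < t := lt_trans ltr01 t1.
have aE : a%:~R = t ^+ 2 - t + eta by rewrite /eta; ring.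
have uE : a%:~R + t + t ^+ 2 = 2 * t ^+ 2 + eta by rewrite aE; ring.
have u0 : 0 < 2 * t ^+ 2 + eta by rewrite addr_gt0 // mulr_gt0 // exprn_gt0.
have b1 : beta1 R alpha a = (2 * t ^+ 2 + eta)%:C by rewrite beta1E -/t uE.
have b10 : beta1 R alpha a != 0 by rewrite gt_eqF // b1 ltcR.
have -> : 2 * (beta2 R alpha a / beta1 R alpha a) - - omega R =
    (2 * beta2 R alpha a + omega R * beta1 R alpha a) / beta1 R alpha a by field.
rewrite normf_div b1 norm_real_complex (gtr0_norm u0) mulrA.
rewrite ler_pdivrMr ?ltcR //.
rewrite -(@ler_pXn2r _ 2) ?nnegrE //; last first.
- by rewrite mulr_ge0 // ler0c ltW.
- by rewrite mulr_ge0 // ler0c ltW.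
have -> : 2 * beta2 R alpha a + omega R * (2 * t ^+ 2 + eta)%:C =
    (- 3 * t + 3 / 2 * eta) +i* (Num.sqrt 3 / 2 * (2 * t + eta)).
  rewrite beta2E -/t aE omegaE -(rmorph_nat (real_complex R)).
  by simpc; congr (_ +i* _); field.
rewrite exprMn -add_Re2_Im2 /= exprMn expr_div_n sqr_sqrtr //.
rewrite -(rmorph_nat (real_complex R)) -rmorphM -!rmorphXn -rmorphM /= lecR.
have e03 : 0 <= 3 - eta by rewrite subr_ge0 ltW.
have {}e0 := ltW e0; have {}t0 := ltW t0.
(* The difference of the sides is 4 t^4 + 6 t^3 eta + 7 t^2 eta + 3 t^2 eta (3 - eta) + 4 eta^2. *)
have p1 := mulr_ge0 (sqr_ge0 t) (mulr_ge0 e0 e03).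
have p2 := mulr_ge0 (sqr_ge0 t) e0.
have p3 := mulr_ge0 (exprn_ge0 3 t0) e0.
have p4 := sqr_ge0 eta; have p5 := exprn_ge0 4 t0.
clear -p1 p2 p3 p4 p5; clearbody eta; clearbody t; lra.
Qed.

(** Telescoping inside the closed unit disc; the factor n in front of [delta3] comes from here. *)
Lemma dist_pow_le (K : numDomainType) (x y : K) (n : nat) :
  `|x| <= 1 -> `|y| <= 1 -> `|x ^+ n - y ^+ n| <= n%:R * `|x - y|.
Proof.
move=> x1 y1; elim: n => [|n IHn]; first by rewrite subrr normr0 mul0r.
have -> : x ^+ n.+1 - y ^+ n.+1 = x * (x ^+ n - y ^+ n) + (x - y) * y ^+ n.
  by rewrite !exprS; ring.
rewrite (le_trans (ler_normD _ _)) // -natr1 [(_ + 1) * _]mulrDl mul1r !normrM.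
rewrite lerD //; first by rewrite (le_trans _ IHn) // ler_piMl.
by rewrite ler_piMr // normrX exprn_ile1.
Qed.

Lemma entry_quot_expansion (R : realType) (alpha a : int) (n : nat)
    (t := cbrt R alpha) (eta := a%:~R - t ^+ 2 + t) :
  1 < alpha -> 0 < eta < 3 -> (3 <= n)%N ->
  (cbrt_mx alpha a ^+ n) 2 0 != 0
  /\ exists delta3 delta4 : R[i],
    [/\ `|delta3| <= 8, `|delta4| <= 48
      & (entry_quot R alpha a n - t)%:C =
        ((omega R - 1) * omega R
           * ((- omega R / 2) ^+ n - (- omega R ^+ 2 / 2) ^+ n)
         + n%:R * delta3 / (2 ^+ n * t%:C)
         + delta4 / 2 ^+ (2 * n)) * t%:C].
Proof.
move=> h he n3; have t1 := cbrt_gt1 R alpha h; rewrite -/t in t1.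
have t0 : 0 < t := lt_trans ltr01 t1.
have u0 : 0 < a%:~R + t + t ^+ 2.
  have -> : a%:~R + t + t ^+ 2 = 2 * t ^+ 2 + eta by rewrite /eta; ring.
  by case/andP: he => e0 _; rewrite addr_gt0 // mulr_gt0 // exprn_gt0.
set m := beta2 R alpha a / beta1 R alpha a; set w := omega R.
have mr : `|m| = (conv_ratio R alpha a)%:C by exact: conv_ratio_norm.
have m2 : `|2 * m| <= 1.
  rewrite normrM mr (normr_nat _ 2) -(rmorph_nat (real_complex R)).
  rewrite -rmorphM /= -(rmorph1 (real_complex R)) lecR.
  by have := conv_ratio_le_half R alpha a h he; lra.
set X := (2 * m) ^+ n; set E : R[i] := 2 ^+ n.
have E0 : E != 0 by rewrite expf_neq0 // pnatr_eq0.
have X1 : `|X| <= 1 by rewrite normrX exprn_ile1.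
have XJ : conjc X = (2 * conjc m) ^+ n by rewrite rmorphXn rmorphM rmorph_nat.
have mX : m ^+ n = X / E by rewrite /X [(2 * m) ^+ n]exprMn -/E mulrAC divff // mul1r.
have mXJ : (conjc m) ^+ n = conjc X / E 
  by rewrite XJ [(2 * _) ^+ n]exprMn -/E mulrAC divff // mul1r.
(* Here n >= 3 enters: with r <= 1/2, 2 r^n is at most 1/4. *)
have hd : `|conv_denom R m n - 1| <= (1 / 2)%:C.
  rewrite (le_trans (conv_denom_dist R m n)) // mr.
  rewrite -(rmorph_nat (real_complex R)) -rmorphXn -rmorphM /= lecR.
  have r0 := conv_ratio_ge0 R alpha a.
  have r1 := conv_ratio_le_half R alpha a h he.
  have : conv_ratio R alpha a ^+ n <= (1 / 2) ^+ 3.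
    apply: le_trans (_ : _ <= conv_ratio R alpha a ^+ 3) _.
      by apply: ler_wiXn2l => //; lra.
    by rewrite ler_pXn2r ?nnegrE //; lra.
  by clear; lra.
have /andP[d1 _] := norm_near1 R _ _ hd.
have d2 : 1 / 2 <= `|conv_denom R m n|.
  rewrite -ReK_norm -(rmorph_nat (real_complex R)) -(rmorph1 (real_complex R)).
  by rewrite -fmorphV -rmorphM lecR; clear -d1; lra.
have d0 : conv_denom R m n != 0 by rewrite -normr_gt0 (lt_le_trans _ d2).
have [z0 ->] := entry_quot_error R alpha a n h u0 d0; split=> //.
set d := conv_denom R m n in d2 d0 *.
rewrite -/w -/m -/t mX mXJ.
have dE : d = 1 + (w * X + w ^+ 2 * conjc X) / E.
  by rewrite /d /conv_denom mX mXJ -/w !mulrA -addrA -mulrDl.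
set Y := (- w) ^+ n; set Y' := (- w ^+ 2) ^+ n.
have YJ : conjc Y = Y' 
  by rewrite /Y rmorphXn rmorphN; congr ((- _) ^+ n); exact: omega_conj.
have t0C : t%:C != 0 by rewrite gt_eqF // ltcR.
have ngt0 : (0 < n)%N by exact: leq_trans n3.
have n0 : n%:R != 0 :> R[i] by rewrite pnatr_eq0 -lt0n.
have XY : `|X - Y| <= n%:R * `|2 * m - - w|.
  by apply: dist_pow_le => //; rewrite normrN norm_omega.
have XYJ : `|conjc X - Y'| = `|X - Y| by rewrite -YJ -rmorphB normcJ.
have YE : (- w / 2) ^+ n = Y / E by exact: expr_div_n.
have YE' : (- w ^+ 2 / 2) ^+ n = Y' / E by exact: expr_div_n.
have EE : 2 ^+ (2 * n) = E ^+ 2 by rewrite mulnC exprM.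
have hb := beta_ratio_dist_omega R alpha a h he.
rewrite -/m -/w -/t in hb; rewrite {}YE {}YE' {}EE.
move: hb XY; set v := `|_ - - w| => hb XY.
have w1 : `|w| = 1 by exact: norm_omega.
have w2 : `|w ^+ 2 - w| <= 2 by exact: norm_omega2B_le2.
have v0 : 0 <= v by exact: normr_ge0.
have tC0 : 0 <= t%:C by rewrite ler0c ltW.
have tC : `|t%:C| = t%:C by rewrite norm_real_complex gtr0_norm.
clear mX mXJ XJ hd d1 YJ mr m2.
clearbody v d Y Y' X E w m; clear he u0.
(* [delta3] collects the cost of replacing 2 m by - w in the numerator. *)
exists (t%:C * (w ^+ 2 - w) * ((X - Y) - (conjc X - Y')) / n%:R).
(* [delta4] collects the cost of replacing 1 / d by 1, as 1 / d - 1 = - (d - 1) / d and d - 1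
   carries a second factor 1 / E. *)
exists (- (w ^+ 2 - w) * (X - conjc X) * (w * X + w ^+ 2 * conjc X) / d).
split.
(* The bound 8 is 2 * 2 * (t v) with t v <= 2. *)
- have hD : `|X - Y - (conjc X - Y')| <= 2 * (n%:R * v).
    by apply: le_trans (ler_normB _ _) _; rewrite XYJ mulr_natl mulr2n lerD.
  rewrite normf_div !normrM tC normr_nat ler_pdivrMr ?ltr0n //.
  apply: le_trans (_ : t%:C * 2 * (2 * (n%:R * v)) <= _).
    by rewrite ler_pM ?mulr_ge0 // ler_wpM2l.
  rewrite [leLHS](_ : _ = 4 * n%:R * (t%:C * v)); last by ring.
  rewrite [leRHS](_ : _ = 4 * n%:R * 2); last by ring.
  by rewrite ler_wpM2l // mulr_ge0.
(* Three factors of modulus at most 2 over |d| >= 1/2 give 16, within 48. *)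
- have h1 : `|X - conjc X| <= 2.
    by apply: le_trans (ler_normB _ _) _; rewrite normcJ mulr2n lerD.
  have h2 : `|w * X + w ^+ 2 * conjc X| <= 2.
    apply: le_trans (ler_normD _ _) _.
    by rewrite !normrM normcJ w1 !mul1r mulr2n lerD.
  rewrite normf_div !normrM normrN ler_pdivrMr ?normr_gt0 //.
  apply: le_trans (_ : 2 * 2 * 2 <= _); first by rewrite !ler_pM ?mulr_ge0.
  apply: le_trans (ler_wpM2l _ d2) => //.
  by rewrite mulrA mulr1 ler_pdivlMr // -!natrM ler_nat.
- have wE : w * X + w ^+ 2 * conjc X = (d - 1) * E.
    by rewrite dE addrAC subrr add0r divfK.
  rewrite wE; field.
  by rewrite t0C n0 E0 d0.
Qed.

Theorem theorem3 (R : realType) (alpha : int) (halpha : 1 < alpha) :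
  (forall a : int, admissible R alpha a ->
    [/\ char_poly (map_mx intr (cbrt_mx alpha a) : 'M[R[i]]_3) =
          ('X - (beta1 R alpha a)%:P) * ('X - (beta2 R alpha a)%:P)
            * ('X - (beta3 R alpha a)%:P),
        `|beta2 R alpha a| < beta1 R alpha a,
        `|beta2 R alpha a| = `|beta3 R alpha a|,
        entry_quot R alpha a n @[n --> \oo] --> cbrt R alpha
      & geometric_rate (entry_quot R alpha a) (cbrt R alpha)
          (conv_ratio R alpha a)])
  /\ (exists a : int, fastest R alpha a)
  /\ (forall a : int, fastest R alpha a ->
        one_of_two_closest (abar R alpha) a
        /\ (forall n : nat, (3 <= n)%N ->
             (cbrt_mx alpha a ^+ n) 2 0 != 0
             /\ exists delta3 delta4 : R[i],
                  [/\ `|delta3| <= 8, `|delta4| <= 48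
                    & (entry_quot R alpha a n - cbrt R alpha)%:C =
                      ((omega R - 1) * omega R
                         * ((- omega R / 2) ^+ n - (- omega R ^+ 2 / 2) ^+ n)
                       + n%:R * delta3 / (2 ^+ n * (cbrt R alpha)%:C)
                       + delta4 / 2 ^+ (2 * n)) * (cbrt R alpha)%:C])).
Proof.
split; [|split; first exact: fastest_exists].
  move=> a ha; split.
  - exact: cbrt_mx_char_poly.
  - exact: norm_beta2_lt_beta1.
  - by rewrite beta3_conj normcJ.
  - apply: geometric_rate_cvg (entry_quot_rate R alpha a halpha ha).
    by rewrite conv_ratio_ge0 conv_ratio_lt1.
  - exact: entry_quot_rate.
move=> a fa; split.
  have [kk _] := abar_floor R alpha halpha.
  have [f1 f2] := one_of_two_closest_itv R _ _ kk.
  by have [->|->] := fastest_floor_or_ceil R alpha a halpha fa.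
move=> n; apply: entry_quot_expansion => //.
by apply: abar_dist_lt1 => //; exact: fastest_dist_abar.
Qed.
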